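(* Let $S\in\Gamma_{1,2}$ with $\operatorname{tr}S>2$. Let $\mathcal N$ be an infinite set of positive integers admissible for $S$, and for each $N\in\mathcal N$ let $\Lambda_N\subset(\mathbb Z/N\mathbb Z)^2$ be a free principal eigenmodule of $S$ modulo $N$. Then for every continuous function $f$ on $\mathbb T^2=(\mathbb R/\mathbb Z)^2$, $$\lim_{N\to\infty,\ N\in\mathcal N}\langle f\rangle_{\Lambda_N}=\int_{\mathbb T^2}f(\vec x)\,d^2x .$$
   Context: $\Gamma_{1,2}\subset \mathrm{SL}(2,\mathbb Z)$ is the subgroup of matrices congruent mod 2 to $\begin{pmatrix}1&0\\0&1\end{pmatrix}$ or $\begin{pmatrix}0&1\\1&0\end{pmatrix}$. A free principal submodule of $(\mathbb Z/N\mathbb Z)^2$ is a submodule $\Lambda=\{n\vec v:\ n\in\mathbb Z/N\mathbb Z\}$ generated by one vector $\vec v$ and having exactly $N$ elements (equivalently, the two coordinates of $\vec v$ and $N$ are globally coprime). It is an eigenmodule of $S$ (an $S$-invariant sublattice) if $S\vec v\equiv\lambda\vec v$ mod $N$ for some $\lambda\in\mathbb Z/N\mathbb Z$. An integer $N\ge1$ is admissible (for $S$) if $S$ has at least one free principal eigenmodule in $(\mathbb Z/N\mathbb Z)^2$. For such $\Lambda_N$ with generator $\vec v$, $\langle f\rangle_{\Lambda_N}=\frac1N\sum_{n=1}^N f(n\vec v/N)$ is the average of $f$ over the $N$ points of $\Lambda_N/N\subset\mathbb T^2$. *)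

(* Defs.v *)
From HB Require Import structures.
From mathcomp Require Import all_boot all_order all_algebra.
From mathcomp Require Import all_classical all_reals all_analysis.
From mathcomp Require Import generic_quotient ring_quotient complex.

Set Implicit Arguments.
Unset Strict Implicit.
Unset Printing Implicit Defensive.

Import Order.TTheory GRing.Theory Num.Theory.
Import numFieldNormedType.Exports.

Local Open Scope classical_set_scope.
Local Open Scope ring_scope.
Local Open Scope quotient_scope.

Definition congr_mx (d : int) (A B : 'M[int]_2) : Prop :=
  forall i j, (A i j = B i j %[mod d])%Z.

(* [tperm_mx 0 1] is the matrix with rows (0, 1) and (1, 0). *)
Definition Gamma12 : set 'M[int]_2 :=
  [set A | \det A = 1 /\ (congr_mx 2 A 1%:M \/ congr_mx 2 A (tperm_mx 0 1))].

(* Z/NZ for N >= 1, as an additive group; 'Z_N would not give the trivial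
   group for N = 1. A scalar n in Z/NZ acts on (Z/NZ)^2 by
   [v *+ n], which depends only on the class of n. For N = 0 the type
   is junk, but no submodule has 0 elements, so N = 0 never qualifies below. *)
Definition Zmod (N : nat) := 'I_(N.-1.+1).

Definition Zmod2 (N : nat) := 'cV[Zmod N]_2.

Definition mx_act (N : nat) (A : 'M[int]_2) (v : Zmod2 N) : Zmod2 N :=
  \col_i \sum_j v j 0 *~ A i j.

Definition principal (N : nat) (v : Zmod2 N) : {set Zmod2 N} :=
  [set v *+ n | n : Zmod N]%SET.

Definition free_principal_eigenmodule (A : 'M[int]_2) (N : nat)
    (L : {set Zmod2 N}) : Prop :=
  exists v : Zmod2 N,
    [/\ L = principal v, #|L| = N & exists l : Zmod N, mx_act A v = v *+ l].

Definition admissible (A : 'M[int]_2) (N : nat) : Prop :=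
  (0 < N)%N /\ exists L : {set Zmod2 N}, free_principal_eigenmodule A L.

Definition int_pred (R : realType) : {pred R} := fun x => x \is a Num.int.

Fact int_zmod_closed (R : realType) : zmod_closed (@int_pred R).
Proof. by split=> [|x y]; [exact: rpred0 | exact: rpredB]. Qed.

Definition int_subgroup (R : realType) : zmodClosed R :=
  HB.pack (@int_pred R) (GRing.isZmodClosed.Build R _ (@int_zmod_closed R)).

(* R/Z with the quotient group structure and the quotient topology *)
Definition circle (R : realType) :=
  quotient_topology {ideal_quot (int_subgroup R)}.

Definition torus (R : realType) := (circle R * circle R)%type.

Definition to_torus (R : realType) (x : R * R) : torus R :=
  (\pi_(circle R) x.1, \pi_(circle R) x.2).

(* w / N, computed from the representatives of w in {0, ..., N - 1}; another
   choice of representatives gives the same point of the torus. *)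
Definition torsion_point (R : realType) (N : nat) (w : Zmod2 N) : torus R :=
  to_torus ((w 0 0 : nat)%:R / N%:R, (w 1 0 : nat)%:R / N%:R).

Definition average (R : realType) (N : nat) (f : torus R -> R[i]^o)
    (v : Zmod2 N) : R[i]^o :=
  N%:R^-1 * \sum_(1 <= n < N.+1) f (torsion_point R (v *+ n)).

(* The integral over the torus, computed over the fundamental domain
   [0, 1)^2; the real and imaginary parts are integrated separately since
   the library only has real integrands. *)
Definition torus_integral (R : realType) (f : torus R -> R[i]^o) : R[i]^o :=
  let mu := (@lebesgue_measure R \x @lebesgue_measure R)%E in
  let D := (`[0%R, 1%R[ `*` `[0%R, 1%R[)%classic in
  Complex (Rintegral mu D (fun x => complex.Re (f (to_torus x))))
          (Rintegral mu D (fun x => complex.Im (f (to_torus x)))).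

(* Main.v *)
(** An eigenmodule lifts to an [S]-invariant lattice [L] in [Z^2] containing
    [N Z^2] with index [N]. By the pigeonhole principle [L] contains a nonzero
    vector [w] of sup norm less than [N / K] as soon as [K^2 < N]. Since
    [tr S ^ 2 - 4] is not a square, [S] has no rational eigenvector, so [w] and
    [S w], both of length [O(N / K)], are independent vectors of [L]: hence
    the finite subgroup [H = L / N] of the torus is [O(1 / K)]-dense.
    The function [F x], the average of [f] over [x + H], has the same average as
    [f] over the grid [(1/N) Z^2], and being [H]-invariant it is within the
    modulus of continuity of [f] at [O(1 / K)] of the constant [F 0], which is
    the average to be estimated. So that average is close to a Riemann sum of
    [f]. *)

Require Import Defs.
From HB Require Import structures.
From mathcomp Require Import all_boot all_order all_algebra.
From mathcomp Require Import all_classical all_reals all_analysis.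
From mathcomp Require Import measurable_realfun.
From mathcomp Require Import generic_quotient ring_quotient complex.
From mathcomp Require Import zify ring lra.
Import Order.TTheory GRing.Theory Num.Theory.
Import numFieldNormedType.Exports.
Local Open Scope classical_set_scope.
Local Open Scope ring_scope.

(** * Short vectors and covering radius of an invariant lattice in Z^2 *)

(** Equality would make [y ^+ 2] divide [x ^+ 2], hence [y] divide [x], and the quotient would be a
    square root of [t ^+ 2 - 4]. For [t >= 3] that number lies strictly between [(t - 1) ^+ 2] and
    [t ^+ 2]. *)
Lemma sqr_subr4_not_square (t x y : int) :
  2 < t -> y != 0 -> x ^+ 2 != (t ^+ 2 - 4) * y ^+ 2.
Proof.
move=> t2 y0; apply/eqP => xy.
have : (`|y| %| `|x|)%N.
  by rewrite -(@dvdn_pexp2r _ _ 2)// -!abszX xy abszM dvdn_mull.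
case/dvdnP => z xz.
have zE : (z%:Z) ^+ 2 = t ^+ 2 - 4.
  apply: (@mulIf _ (y ^+ 2)); first by rewrite expf_eq0.
  rewrite -xy -exprMn -(real_normK (num_real x)).
  rewrite -(real_normK (num_real (_ * y))).
  by rewrite normrM -!abszE xz PoszM.
case: (leP (z%:Z) (t - 1)) => zt; last by nia.
have [zt2|] := leP (z%:Z) (t - 2); nia.
Qed.

(* The left-hand side is a binary quadratic form of discriminant
   [(a + d) ^+ 2 - 4]. *)
Lemma hyperbolic_orbit_independent (a b c d x y : int) :
  a * d - b * c = 1 -> 2 < a + d -> (x != 0) || (y != 0) ->
  x * (c * x + d * y) - y * (a * x + b * y) != 0.
Proof.
move=> det1 tr2 xy0; apply/eqP => Q0.
have [y0|y0] := eqVneq y 0.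
  (* The form is now [c * x ^+ 2], so [c = 0] and [a * d = 1], and the discriminant would be the
     square [(d - a) ^+ 2]. *)
  move: xy0 Q0; rewrite y0 eqxx orbF !(mulr0, mul0r, addr0, subr0) => x0 /eqP.
  rewrite !mulf_eq0 (negbTE x0) orbF /= => /eqP c0.
  apply: (negP (sqr_subr4_not_square (a + d) (d - a) 1 tr2 isT)); apply/eqP.
  move: det1; rewrite c0 mulr0 subr0 => ad1.
  have -> : (4 : int) = 4 * (a * d) by rewrite ad1 mulr1.
  ring.
(* Complete the square: [4 * c] times the form is [(2 * c * x + (d - a) * y) ^+ 2] minus the
   discriminant times [y ^+ 2]. *)
apply: (negP (sqr_subr4_not_square (a + d) (2 * c * x + (d - a) * y) y tr2 y0)).
have -> : (4 : int) = 4 * (a * d - b * c) by rewrite det1 mulr1.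
apply/eqP; transitivity (4 * c * (x * (c * x + d * y) - y * (a * x + b * y)) +
  ((a + d) ^+ 2 - 4 * (a * d - b * c)) * y ^+ 2); first by ring.
by rewrite Q0 mulr0 add0r.
Qed.

(** Cut the square of side N into K^2 cells of side N / K. Two of the N > K^2 multiples of (a, b),
    reduced mod N, share a cell, and (x, y) is their difference. It is nonzero because (a, b) has
    order N modulo N. *)
Lemma pigeonhole_multiple (N K a b : nat) : (0 < K)%N -> (K * K < N)%N ->
  (forall k : nat, (N %| k * a)%N -> (N %| k * b)%N -> (N %| k)%N) ->
  exists x y k : int,
    [/\ (x != 0) || (y != 0), (N %| x - k * a)%Z, (N %| y - k * b)%Z,
        `|x| * K%:Z < N%:Z & `|y| * K%:Z < N%:Z].
Proof.
case: K => // K _ KN ordN; have N0 : (0 < N)%N by exact: leq_ltn_trans KN.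
pose cell (n c : nat) : 'I_K.+1 := inord (n * c %% N * K.+1 %/ N).
have cellE n c : cell n c = (n * c %% N * K.+1 %/ N)%N :> nat.
  by rewrite inordK// ltn_divLR// mulnC ltn_pmul2l// ltn_mod.
have cell_close n n' c : cell n c = cell n' c ->
    `|(n * c %% N)%N%:Z - (n' * c %% N)%N%:Z| * K.+1%:Z < N%:Z.
  move=> /(congr1 (@nat_of_ord _)); rewrite !cellE.
  move: (n * c %% N)%N (n' * c %% N)%N => m m' mm'.
  have := divn_eq (m * K.+1) N; have := divn_eq (m' * K.+1) N.
  have := ltn_pmod (m * K.+1) N0; have := ltn_pmod (m' * K.+1) N0.
  rewrite mm'; nia.
have /injectivePn[i [j ij]] :
    ~~ injectiveb [ffun n : 'I_N => (cell n a, cell n b)].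
  apply/negP => /injectiveP/leq_card; rewrite card_prod !card_ord.
  by rewrite leqNgt KN.
rewrite !ffunE => -[ija ijb].
exists ((i * a %% N)%N%:Z - (j * a %% N)%N%:Z).
exists ((i * b %% N)%N%:Z - (j * b %% N)%N%:Z), (i%:Z - j%:Z).
have modE c : (N %| (i * c %% N)%N%:Z - (j * c %% N)%N%:Z -
                    (i%:Z - j%:Z) * c%:Z)%Z.
  apply/dvdzP; exists ((j * c %/ N)%N%:Z - (i * c %/ N)%N%:Z).
  have := divn_eq (i * c) N; have := divn_eq (j * c) N; nia.
split; rewrite ?modE//; last 2 first.
- exact: cell_close.
- exact: cell_close.
apply: contraNT ij; rewrite negb_or !negbK => /andP[/eqP x0 /eqP y0].
have dvd_ij c : (i * c %% N)%N%:Z - (j * c %% N)%N%:Z = 0 ->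
    (N %| `|i%:Z - j%:Z| * c)%N.
  by have := modE c => /[swap] ->; rewrite sub0r dvdzE abszN abszM.
have := ordN _ (dvd_ij a x0) (dvd_ij b y0) => /dvdnP[q qN].
apply/eqP/val_inj => /=; have := ltn_ord i; have := ltn_ord j.
case: q qN => [|q]; nia.
Qed.

Lemma lattice_covering (x y x' y' i j : int) : x * y' - y * x' != 0 ->
  exists q q' : int, `|i - (q * x + q' * x')| <= `|x| + `|x'| /\
                     `|j - (q * y + q' * y')| <= `|y| + `|y'|.
Proof.
set D := x * y' - y * x' => D0.
(* Cramer's rule with coefficients rounded by Euclidean division. *)
pose r := ((i * y' - j * x') %% D)%Z; pose r' := ((j * x - i * y) %% D)%Z.
exists ((i * y' - j * x') %/ D)%Z, ((j * x - i * y) %/ D)%Z.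
have rD : `|r| <= `|D| by rewrite ger0_norm ?modz_ge0// ltW// ltz_mod.
have r'D : `|r'| <= `|D| by rewrite ger0_norm ?modz_ge0// ltW// ltz_mod.
have e := divz_eq (i * y' - j * x') D; have e' := divz_eq (j * x - i * y) D.
rewrite -/r -/r' in e e'.
have Dgt0 : 0 < `|D| by rewrite normr_gt0.
(* [r / D] and [r' / D] are the rounding errors of the two coefficients, at most 1 in absolute
   value. *)
have small z z' w : w * D = r * z + r' * z' -> `|w| <= `|z| + `|z'|.
  move=> wD; rewrite -(ler_pM2r Dgt0) -normrM wD (le_trans (ler_normD _ _))//.
  by rewrite !normrM mulrDl lerD// mulrC ler_wpM2l.
move: r r' ((i * y' - j * x') %/ D)%Z ((j * x - i * y) %/ D)%Z =>
  r r' q q' in e e' rD r'D small *.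
have {}e : r = (i * y' - j * x') - q * D by rewrite e addrC addKr.
have {}e' : r' = (j * x - i * y) - q' * D by rewrite e' addrC addKr.
by split; apply: small; rewrite e e' /D; ring.
Qed.

(** The constant depends on the matrix alone: relative to N the covering radius is C / K, uniformly
    in the eigenvector, and K may be any integer with K^2 < N. *)
Lemma eigenlattice_covering (a b c d : int) :
  a * d - b * c = 1 -> 2 < a + d ->
  exists C : int, forall (N K v1 v2 : nat) (l : int),
    (0 < K)%N -> (K * K < N)%N ->
    (forall k : nat, (N %| k * v1)%N -> (N %| k * v2)%N -> (N %| k)%N) ->
    (N %| a * v1%:Z + b * v2%:Z - l * v1%:Z)%Z ->
    (N %| c * v1%:Z + d * v2%:Z - l * v2%:Z)%Z ->
    forall i j : int, exists k u w : int,
      `|i - (k * v1%:Z + u * N%:Z)| * K%:Z <= C * N%:Z /\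
      `|j - (k * v2%:Z + w * N%:Z)| * K%:Z <= C * N%:Z.
Proof.
(* The coordinates of the short vector w are at most N / K, those of its image at most (|a| + |b|) N
   / K and (|c| + |d|) N / K. This constant serves both coordinates. *)
move=> det1 tr2; exists (1 + `|a| + `|b| + `|c| + `|d|).
move=> N K v1 v2 l K0 KN ordN eig1 eig2 i j.
have [x [y [k [xy0 xk yk xK yK]]]] := pigeonhole_multiple N K v1 v2 K0 KN ordN.
have := hyperbolic_orbit_independent a b c d x y det1 tr2 xy0.
move=> /(lattice_covering _ _ _ _ i j)[q [q' [iq jq]]].
have linN (s t z z' : int) : `|s * z + t * z'| <= `|s| * `|z| + `|t| * `|z'|.
  by rewrite (le_trans (ler_normD _ _))// !normrM.
have := linN a b x y; have := linN c d x y => lin2 lin1.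
move: xk yk eig1 eig2 => /dvdzP[g1 xk] /dvdzP[g2 yk]
  /dvdzP[g3 eig1] /dvdzP[g4 eig2].
(* Write w = k v + N g. As v is an eigenvector mod N, the image of w is k l v plus a multiple of N,
   so these are the coefficients of q w + q' S w. *)
exists (q * k + q' * k * l).
exists (q * g1 + q' * (a * g1 + b * g2 + k * g3)).
exists (q * g2 + q' * (c * g1 + d * g2 + k * g4)).
have {}xk : x = g1 * N%:Z + k * v1%:Z by rewrite -xk subrK.
have {}yk : y = g2 * N%:Z + k * v2%:Z by rewrite -yk subrK.
have {}eig1 : l * v1%:Z = a * v1%:Z + b * v2%:Z - g3 * N%:Z.
  by rewrite -eig1; ring.
have {}eig2 : l * v2%:Z = c * v1%:Z + d * v2%:Z - g4 * N%:Z.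
  by rewrite -eig2; ring.
have -> : (q * k + q' * k * l) * v1%:Z +
    (q * g1 + q' * (a * g1 + b * g2 + k * g3)) * N%:Z =
    q * x + q' * (a * x + b * y).
  transitivity (q * x + q' * (a * g1 + b * g2 + k * g3) * N%:Z +
    q' * k * (l * v1%:Z)).
    by rewrite xk; ring.
  by rewrite eig1 xk yk; ring.
have -> : (q * k + q' * k * l) * v2%:Z +
    (q * g2 + q' * (c * g1 + d * g2 + k * g4)) * N%:Z =
    q * y + q' * (c * x + d * y).
  transitivity (q * y + q' * (c * g1 + d * g2 + k * g4) * N%:Z +
    q' * k * (l * v2%:Z)).
    by rewrite yk; ring.
  by rewrite eig2 xk yk; ring.
have K0' : 0 <= K%:Z by [].
split.
- apply: (le_trans (ler_wpM2r K0' iq)).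
  apply: (le_trans (ler_wpM2r K0' (lerD (lexx _) lin1))).
  rewrite !mulrDl mul1r -!mulrA.
  have := ler_wpM2l (normr_ge0 a) (ltW xK);
  have := ler_wpM2l (normr_ge0 b) (ltW yK).
  have := mulr_ge0 (normr_ge0 c) (ler0n int N);
  have := mulr_ge0 (normr_ge0 d) (ler0n int N).
  lia.
- apply: (le_trans (ler_wpM2r K0' jq)).
  apply: (le_trans (ler_wpM2r K0' (lerD (lexx _) lin2))).
  rewrite !mulrDl mul1r -!mulrA.
  have := ler_wpM2l (normr_ge0 c) (ltW xK);
  have := ler_wpM2l (normr_ge0 d) (ltW yK).
  have := mulr_ge0 (normr_ge0 a) (ler0n int N);
  have := mulr_ge0 (normr_ge0 b) (ler0n int N).
  lia.
Qed.

(** * Averages over an orbit and over the full grid *)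

Lemma sum_periodic_shift (V : zmodType) (N : nat) (h : int -> V) (k : int) :
  (forall i m : int, h (i + m * N%:Z) = h i) ->
  \sum_(i < N) h (i%:Z + k) = \sum_(i < N) h i%:Z.
Proof.
move=> hper; case: N hper => [|N] hper; first by rewrite !big_ord0.
have shift_nat (n : nat) :
    \sum_(i < N.+1) h (i%:Z + n%:Z) = \sum_(i < N.+1) h i%:Z.
  elim: n => [|n IHn]; first by under eq_bigr do rewrite addr0.
  rewrite -[RHS]IHn [RHS]big_ord_recl [LHS]big_ord_recr /= addrC; congr (_ + _).
    by rewrite -[in RHS](hper _ 1) mul1r add0r; congr h; lia.
  by apply: eq_bigr => i _; congr h; rewrite /bump /=; lia.
(* By periodicity an integer shift may be replaced by its nonnegative remainder. *)
rewrite -(shift_nat `|(k %% N.+1%:Z)%Z|%N); apply: eq_bigr => i _.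
rewrite gez0_abs ?modz_ge0// {1}(divz_eq k N.+1%:Z).
by rewrite (addrC (_ * _)) addrA hper.
Qed.

Lemma orbit_average_near_grid_average (R : realFieldType) (N : nat)
    (v1 v2 : int) (G : int -> int -> R) (e : R) : (0 < N)%N ->
  (forall i j m, G (i + m * N%:Z) j = G i j) ->
  (forall i j m, G i (j + m * N%:Z) = G i j) ->
  (forall i j : int, exists k u w : int, forall p q : int,
     `|G (i - (k * v1 + u * N%:Z) + p) (j - (k * v2 + w * N%:Z) + q) - G p q|
       <= e) ->
  `|N%:R^-1 * \sum_(n < N) G (n%:Z * v1) (n%:Z * v2) -
    N%:R^-1 ^+ 2 * \sum_(i < N) \sum_(j < N) G i%:Z j%:Z| <= e.
Proof.
move=> N0 Gl Gr cover.
(* The sum of [G] over the translate of the orbit by (i, j), left unnormalised: N times the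
   average. *)
pose F i j := \sum_(n < N) G (i + n%:Z * v1) (j + n%:Z * v2).
have N0R : (N%:R : R) != 0 by rewrite pnatr_eq0 -lt0n.
have sumF : \sum_(i < N) \sum_(j < N) F i%:Z j%:Z =
    N%:R * \sum_(i < N) \sum_(j < N) G i%:Z j%:Z.
  under eq_bigr do rewrite exchange_big /=.
  rewrite exchange_big /=.
  rewrite (eq_bigr (fun=> \sum_(i < N) \sum_(j < N) G i%:Z j%:Z)).
    by rewrite sumr_const card_ord mulr_natl.
  move=> n _; rewrite -[RHS](sum_periodic_shift _ N
    (fun i => \sum_(j < N) G i j%:Z) (n%:Z * v1)).
    by apply: eq_bigr => i _; rewrite sum_periodic_shift.
  by move=> i m; apply: eq_bigr => j _.
have F_near i j : `|F i j - F 0 0| <= N%:R * e.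
  have [k [u [w near]]] := cover i j.
  (* Translation by k v only reindexes the orbit, and translation by N (u, w) is a period of [G]. *)
  have -> : F i j = F (i - (k * v1 + u * N%:Z)) (j - (k * v2 + w * N%:Z)).
    rewrite /F -[RHS](sum_periodic_shift _ N (fun n =>
      G (i - (k * v1 + u * N%:Z) + n * v1)
        (j - (k * v2 + w * N%:Z) + n * v2)) k).
      apply: eq_bigr => n _; rewrite -[RHS](Gl _ _ u) -[RHS](Gr _ _ w).
      by congr G; ring.
    move=> n m; rewrite -[RHS](Gl _ _ (m * v1)) -[RHS](Gr _ _ (m * v2)).
    by congr G; ring.
  rewrite /F -sumrB (le_trans (ler_norm_sum _ _ _))//.
  rewrite mulr_natl -[N in leRHS]card_ord -sumr_const ler_sum// => n _.
  by rewrite !add0r near.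
(* By [sumF] the difference is the mean of [F 0 0 - F i j] over the N^2 grid points, divided by N;
   hence the third power. *)
have -> : N%:R^-1 * \sum_(n < N) G (n%:Z * v1) (n%:Z * v2) -
    N%:R^-1 ^+ 2 * \sum_(i < N) \sum_(j < N) G i%:Z j%:Z =
    N%:R^-1 ^+ 3 * \sum_(i < N) \sum_(j < N) (F 0 0 - F i%:Z j%:Z).
  under [in RHS]eq_bigr do rewrite sumrB sumr_const card_ord.
  rewrite sumrB sumr_const card_ord sumF.
  have -> : F 0 0 = \sum_(n < N) G (n%:Z * v1) (n%:Z * v2).
    by apply: eq_bigr => n _; rewrite !add0r.
  move: N0R (\sum_(n < N) _) (\sum_(i < N) _) => + A B.
  rewrite -(mulr_natl (A *+ N)) -(mulr_natl A).
  by move: (N%:R : R) => X X0; field.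
rewrite normrM ger0_norm ?exprn_ge0 ?invr_ge0//.
rewrite exprVn mulrC ler_pdivrMr ?exprn_gt0 ?ltr0n//.
rewrite (le_trans (ler_norm_sum _ _ _))//.
have -> : e * N%:R ^+ 3 = \sum_(i < N) \sum_(j < N) (N%:R * e).
  rewrite !sumr_const card_ord -(mulr_natl (_ *+ N)) -(mulr_natl (N%:R * e)).
  by move: (N%:R : R) => X; ring.
rewrite ler_sum// => i _; rewrite (le_trans (ler_norm_sum _ _ _))//.
rewrite ler_sum// => j _.
by rewrite distrC.
Qed.

(** * Riemann sums over the unit square *)

Lemma Rintegral_sum d (T : measurableType d) (R : realType)
    (mu : {measure set T -> \bar R}) (D : set T) (I : Type) (s : seq I)
    (f : I -> T -> R) :
  measurable D -> (forall i, mu.-integrable D (EFin \o f i)) ->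
  \int[mu]_(x in D) (\sum_(i <- s) f i x) =
  \sum_(i <- s) \int[mu]_(x in D) f i x.
Proof.
move=> mD intf; rewrite /Rintegral.
under eq_integral do rewrite -sumEFin.
rewrite (integral_sum mD intf).
by rewrite -sum_fine// => i _; exact: (integrable_fin_num mD (intf i)).
Qed.

Definition unit_square (R : realType) : set (R * R) :=
  `[0%R, 1%R[ `*` `[0%R, 1%R[.

(** Half-open, so that the products of cells partition the half-open unit square. *)
Definition grid_cell (R : realType) (N i : nat) : set R :=
  `[i%:R / N%:R, i.+1%:R / N%:R[.

Definition grid_point (R : realType) (N : nat) (p : 'I_N * 'I_N) : R * R :=
  (p.1%:R / N%:R, p.2%:R / N%:R).

(** Its integral is the Riemann sum of [g]; its limits also give measurability of [g]. *)
Definition grid_step (R : realType) (N : nat) (g : R * R -> R)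
    (x : R * R) : R :=
  \sum_(p : 'I_N * 'I_N) g (grid_point R N p) *
    \1_(grid_cell R N p.1 `*` grid_cell R N p.2) x.

Section riemann.
Context {R : realType}.
Implicit Types (g : R * R -> R).
Local Notation mu := (@lebesgue_measure R \x @lebesgue_measure R)%E.
Local Notation D := (unit_square R).

Lemma grid_cellE (N i : nat) (x : R) : (0 < N)%N -> 0 <= x ->
  grid_cell R N i x <-> i = Num.truncn (x * N%:R).
Proof.
move=> N0 x0; rewrite /grid_cell /= in_itv /=.
rewrite ler_pdivrMr ?ltr0n// ltr_pdivlMr ?ltr0n//.
rewrite -Num.Theory.truncn_eq ?mulr_ge0//; split=> [/eqP|->]//.
Qed.

Lemma grid_step_cell (N : nat) g (x : R * R) : (0 < N)%N -> D x ->
  exists p : 'I_N * 'I_N, [/\ grid_cell R N p.1 x.1, grid_cell R N p.2 x.2 &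
    grid_step R N g x = g (grid_point R N p)].
Proof.
move=> N0 [] /=; rewrite !in_itv /= => /andP[x0 x1] /andP[y0 y1].
have idx (z : R) : 0 <= z -> z < 1 -> exists i : 'I_N, grid_cell R N i z.
  move=> z0 z1.
  have zN : (Num.truncn (z * N%:R) < N)%N.
    by rewrite Num.Theory.truncn_lt_nat ?mulr_ge0// gtr_pMl// ltr0n.
  by exists (Ordinal zN); apply/grid_cellE.
have cell_idx i z : 0 <= z -> grid_cell R N i z -> i = Num.truncn (z * N%:R).
  by move=> z0 /(grid_cellE _ _ _ N0 z0).
have [i xi] := idx _ x0 x1; have [j yj] := idx _ y0 y1.
exists (i, j); split => //; rewrite /grid_step (bigD1 (i, j))//=.
rewrite indicE mem_set//= mulr1 big1 ?addr0// => -[i' j'] ij'.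
rewrite indicE memNset ?mulr0//= => -[/= xi' yj'].
move/negP: ij'; apply; apply/eqP; congr pair; apply/val_inj => /=.
  by rewrite (cell_idx _ _ x0 xi) (cell_idx _ _ x0 xi').
by rewrite (cell_idx _ _ y0 yj) (cell_idx _ _ y0 yj').
Qed.

Lemma grid_step_near (N : nat) g (d e : R) : (0 < N)%N -> N%:R^-1 <= d ->
  (forall x y, `|x.1 - y.1| <= d -> `|x.2 - y.2| <= d -> `|g x - g y| <= e) ->
  forall x, D x -> `|grid_step R N g x - g x| <= e.
Proof.
move=> N0 Nd gd x Dx; have [p [px py ->]] := grid_step_cell N g x N0 Dx.
have near (i : nat) z : grid_cell R N i z -> `|i%:R / N%:R - z| <= d.
  rewrite /grid_cell /= in_itv /= -natr1 mulrDl mul1r => /andP[z0 z1].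
  rewrite distrC ger0_norm ?subr_ge0// (le_trans _ Nd)//.
  by rewrite lerBlDl ltW.
by apply: gd => /=; exact: near.
Qed.

Lemma measurable_unit_square : measurable D.
Proof. by apply: measurableX; exact: measurable_itv. Qed.

Lemma measurable_grid_cell N i j :
  measurable (grid_cell R N i `*` grid_cell R N j).
Proof. by apply: measurableX; exact: measurable_itv. Qed.

Lemma measure_unit_square : mu D = 1%E.
Proof.
rewrite /unit_square product_measure1E//= !lebesgue_measure_itv /=.
rewrite !lte_fin !ltr01.
by rewrite sube0 mule1.
Qed.

Lemma measurable_grid_step N g : measurable_fun D (grid_step R N g).
Proof.
apply: measurable_sum => p; apply: measurable_funM => //.
by apply: measurable_indic; exact: measurable_grid_cell.
Qed.

(** Required on the whole plane: the lattice points compared later need not lie in the unit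
    square. *)
Definition sup_unif_continuous g :=
  forall e : R, 0 < e -> exists2 d : R, 0 < d &
  forall x y, `|x.1 - y.1| <= d -> `|x.2 - y.2| <= d -> `|g x - g y| <= e.

Lemma grid_step_cvg g x : sup_unif_continuous g -> D x ->
  grid_step R N.+1 g x @[N --> \oo] --> g x.
Proof.
move=> gunif Dx; apply/cvgrPdistC_le => e e0; have [d d0 gd] := gunif e e0.
near=> N; apply: (grid_step_near N.+1 g d e) => //.
by apply/ltW; near: N; exact: (near_infty_natSinv_lt (PosNum d0)).
Unshelve. all: by end_near. Qed.

(** A pointwise limit of step functions is measurable for the product structure. *)
Lemma sup_unif_continuous_measurable g :
  sup_unif_continuous g -> measurable_fun D g.
Proof.
move=> gunif; apply: (measurable_fun_cvg
  (h := fun N => grid_step R N.+1 g)) => [N|x Dx].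
  exact: measurable_grid_step.
exact: grid_step_cvg.
Qed.

Lemma grid_step_bounded N g (x : R * R) :
  `|grid_step R N g x| <= \sum_(p : 'I_N * 'I_N) `|g (grid_point R N p)|.
Proof.
rewrite (le_trans (ler_norm_sum _ _ _))// ler_sum// => p _.
by rewrite normrM ler_piMr// indicE ger0_norm// lern1 leq_b1.
Qed.

Lemma bounded_integrable_unit_square g (M : R) : measurable_fun D g ->
  (forall x, D x -> `|g x| <= M) -> mu.-integrable D (EFin \o g).
Proof.
move=> mg gM; apply: measurable_bounded_integrable => //.
- exact: measurable_unit_square.
- by rewrite [ltLHS]measure_unit_square ltry.
- exists M; split; first exact: num_real.
  by move=> y My x Dx; exact: le_trans (gM _ Dx) (ltW My).
Qed.

Lemma integrable_grid_step N g : mu.-integrable D (EFin \o grid_step R N g).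
Proof.
apply: (bounded_integrable_unit_square _ (\sum_p `|g (grid_point R N p)|)).
  exact: measurable_grid_step.
by move=> x _; exact: grid_step_bounded.
Qed.

(** On the square [g] is within 1 of a step function on a fine enough grid, hence bounded. *)
Lemma sup_unif_continuous_integrable g : sup_unif_continuous g ->
  mu.-integrable D (EFin \o g).
Proof.
move=> gunif; have [d d0 gd] := gunif 1 ltr01.
have [N _ /(_ N (leqnn _))/ltW Nd] := near_infty_natSinv_lt (PosNum d0).
apply: (bounded_integrable_unit_square _
  (\sum_p `|g (grid_point R N.+1 p)| + 1)).
  exact: sup_unif_continuous_measurable.
move=> x Dx; rewrite -[g x](subKr (grid_step R N.+1 g x)).
rewrite (le_trans (ler_normB _ _))// lerD ?grid_step_bounded//.
exact: grid_step_near gd _ Dx.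
Qed.

Lemma grid_cell_subset N (i : 'I_N) : grid_cell R N i `<=` `[0, 1[.
Proof.
have N0 : 0 < N%:R :> R by rewrite ltr0n (leq_ltn_trans _ (ltn_ord i)).
move=> x; rewrite /grid_cell /= !in_itv /= => /andP[ix xi]; apply/andP; split.
  by rewrite (le_trans _ ix)// divr_ge0// ltW.
by rewrite (lt_le_trans xi)// ler_pdivrMr// mul1r ler_nat.
Qed.

Lemma lebesgue_measure_grid_cell N i : (0 < N)%N ->
  lebesgue_measure (grid_cell R N i) = (N%:R^-1)%:E.
Proof.
move=> N0; rewrite /grid_cell lebesgue_measure_itv /= lte_fin.
rewrite ltr_pM2r ?invr_gt0 ?ltr0n// ltr_nat ltnSn -EFinB -mulrBl.
by rewrite -natr1 addrAC subrr add0r mul1r.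
Qed.

Lemma measure_grid_cell N i j : (0 < N)%N ->
  mu (grid_cell R N i `*` grid_cell R N j) = (N%:R^-1 ^+ 2)%:E.
Proof.
move=> N0; rewrite product_measure1E; [|exact: measurable_itv..].
by rewrite [X in (X * _)%E]lebesgue_measure_grid_cell//
  [X in (_ * X)%E]lebesgue_measure_grid_cell.
Qed.

Lemma Rintegral_grid_step (N : nat) g : (0 < N)%N ->
  \int[mu]_(x in D) grid_step R N g x =
  N%:R^-1 ^+ 2 * \sum_(i < N) \sum_(j < N) g (i%:R / N%:R, j%:R / N%:R).
Proof.
move=> N0; have int1 (p : 'I_N * 'I_N) : mu.-integrable D
    (EFin \o \1_(grid_cell R N p.1 `*` grid_cell R N p.2)).
  apply: (bounded_integrable_unit_square _ 1).
    by apply: measurable_indic; exact: measurable_grid_cell.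
  by move=> x _; rewrite indicE ger0_norm// lern1 leq_b1.
rewrite Rintegral_sum.
- rewrite [in RHS]pair_bigA mulr_sumr /=; apply: eq_bigr => p _.
  rewrite RintegralZl; [|exact: measurable_unit_square|exact: int1].
  rewrite mulrC; congr (_ * _); rewrite /Rintegral integral_indic//.
  + rewrite setIidl; last first.
      move=> x [x1 x2].
      by split; [exact: grid_cell_subset x1|exact: grid_cell_subset x2].
    by rewrite [X in fine X]measure_grid_cell.
  + exact: measurable_unit_square.
  + exact: measurable_grid_cell.
- exact: measurable_unit_square.
- move=> p; apply: (bounded_integrable_unit_square _ `|g (grid_point R N p)|).
    apply: measurable_funM => //.
    by apply: measurable_indic; exact: measurable_grid_cell.
  by move=> x _; rewrite normrM ler_piMr// indicE ger0_norm// lern1 leq_b1.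
Qed.

(** The Riemann sum is the integral of [grid_step], which is within [e] of [g] on a square of
    measure 1. *)
Lemma riemann_sum_near (N : nat) g (d e : R) : sup_unif_continuous g ->
  (0 < N)%N -> N%:R^-1 <= d ->
  (forall x y, `|x.1 - y.1| <= d -> `|x.2 - y.2| <= d -> `|g x - g y| <= e) ->
  `|N%:R^-1 ^+ 2 * \sum_(i < N) \sum_(j < N) g (i%:R / N%:R, j%:R / N%:R) -
    \int[mu]_(x in D) g x| <= e.
Proof.
move=> gunif N0 Nd gd; rewrite -Rintegral_grid_step// -RintegralB//; first last.
- exact: sup_unif_continuous_integrable.
- exact: integrable_grid_step.
- exact: measurable_unit_square.
have intB : mu.-integrable D (EFin \o (fun x => grid_step R N g x - g x)).
  apply: (bounded_integrable_unit_square _ e) => [|x Dx].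
    apply: measurable_funB; first exact: measurable_grid_step.
    exact: sup_unif_continuous_measurable.
  exact: grid_step_near gd _ Dx.
apply: (le_trans (le_normr_Rintegral _ intB)).
  exact: measurable_unit_square.
have -> : e = \int[mu]_(x in D) e.
  rewrite Rintegral_cst; last exact: measurable_unit_square.
  by rewrite [X in fine X]measure_unit_square mulr1.
apply: le_Rintegral.
- exact: measurable_unit_square.
- exact: integrable_norm.
- apply: (bounded_integrable_unit_square _ `|e|) => //.
- by move=> x Dx; exact: grid_step_near gd _ Dx.
Qed.

End riemann.

(** * Uniform continuity of periodic functions *)

(** Compactness of the closed unit square gives one [d] for all base points in it, with
    displacements allowed to leave the square. Periodicity then moves any base point into the
    square. *)
Lemma periodic_continuous_sup_unif_continuous (R : realType) (g : R * R -> R) :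
  continuous g ->
  (forall (x : R * R) (m n : int), g (x.1 + m%:~R, x.2 + n%:~R) = g x) ->
  sup_unif_continuous g.
Proof.
move=> cg pg e e0.
pose near_g d x := forall h : R * R, `|h.1| <= d -> `|h.2| <= d ->
  `|g x - g (x + h)| <= e.
have : \forall d \near (0 : R)^'+,
    (`[0, 1] `*` `[0, 1] : set (R * R)) `<=` near_g d.
  have /compact_near_coveringP := compact_setX
    (@segment_compact R 0 1) (@segment_compact R 0 1).
  apply => x _; have e20 : 0 < e / 2 by rewrite divr_gt0.
  have /cvgrPdist_lt /(_ _ e20) /nbhs_ballP [r /= r0 rP] := cg x.
  have r20 : 0 < r / 2 by rewrite divr_gt0.
  (* With [x'] within [r / 2] of [x] and [d < r / 2], both [x'] and [x' + h] lie in the ball of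
     radius [r] about [x]. *)
  near=> x' d => h h1 h2.
  have [x'1 x'2] : ball x (r / 2) x' by near: x'; exact: nbhsx_ballx.
  have dr : d < r / 2 by near: d; exact: nbhs_right_lt.
  have gx' : `|g x - g x'| < e / 2.
    by apply: rP; apply: le_ball (_ : ball x (r / 2) x') => //; lra.
  have gx'h : `|g x - g (x' + h)| < e / 2.
    apply: rP; split => /=; rewrite /ball /= opprD addrA.
      rewrite (splitr r) (le_lt_trans (ler_normB _ _))// ltrD//.
      exact: le_lt_trans dr.
    rewrite (splitr r) (le_lt_trans (ler_normB _ _))// ltrD//.
    exact: le_lt_trans dr.
  rewrite -(subrKA (g x)) (le_trans (ler_normD _ _))// (splitr e) lerD ?ltW//.
  by rewrite distrC.
move=> near_d; have [d [d0 dP]] : exists d : R, 0 < d /\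
    (`[0, 1] `*` `[0, 1] : set (R * R)) `<=` near_g d.
  apply: (@filter_ex _ (0 : R)^'+); apply: filterI => //; exact: nbhs_right_gt.
exists d => // x y xy1 xy2.
(* The same integer translation takes [x] to [z] and [y] to [z + (y - x)]. *)
pose z : R * R := (x.1 + (- Num.floor x.1)%:~R, x.2 + (- Num.floor x.2)%:~R).
have gzh : g (z + (y - x)) = g y.
  rewrite -[RHS](pg _ (- Num.floor x.1) (- Num.floor x.2)).
  by congr (g (_, _)) => /=; ring.
rewrite -(pg x (- Num.floor x.1) (- Num.floor x.2)) -gzh.
apply: dP; last 2 first.
- by rewrite /= distrC.
- by rewrite /= distrC.
have frac (t : R) : t + (- Num.floor t)%:~R \in `[0, 1].
  have /andP[] := Num.Theory.floor_itv t.
  by rewrite in_itv /= intrD1 rmorphN /=; lra.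
by split; exact: frac.
Unshelve. all: by end_near. Qed.

(** * From submodules of (Z/NZ)^2 to integer congruences *)

Lemma Zmod_mulrnE (N : nat) (x : Zmod N) (n : nat) : (0 < N)%N ->
  (x *+ n : Zmod N) = (x * n %% N)%N :> nat.
Proof. by case: N x => // N x _; rewrite Zp_mulrn. Qed.

(** [inZp 1] is the additive generator, also for the trivial group, where it is zero. *)
Lemma Zp_natmulE (n : nat) (x : 'I_n.+1) : x = (inZp 1 : 'I_n.+1) *+ x.
Proof.
by rewrite Zp_mulrn; apply/val_inj; rewrite /= modnMml mul1n modn_small.
Qed.

Lemma Zp_intmul_eq0 (n : nat) (z : int) :
  (inZp 1 : 'I_n.+1) *~ z = 0 <-> (n.+1 %| z)%Z.
Proof.
have nat_case k : (inZp 1 : 'I_n.+1) *+ k = 0 <-> (n.+1 %| k)%N.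
  rewrite Zp_mulrn; split => [/(congr1 val)/=|/eqP k0].
    by rewrite modnMml mul1n => /eqP.
  by apply/val_inj; rewrite /= modnMml mul1n.
case: z => k; first exact: nat_case.
rewrite NegzE mulrNz dvdzE abszN -nat_case -[_ *~ _]/(_ *+ _).
by split => [/eqP|->]; rewrite ?oppr0// oppr_eq0 => /eqP.
Qed.

Lemma mx_act_mulrn (N : nat) (A : 'M[int]_2) (v : Zmod2 N) (k : nat) :
  mx_act A (v *+ k) = mx_act A v *+ k.
Proof.
apply/matrixP => i j; rewrite mulmxnE !mxE -sumrMnl; apply: eq_bigr => h _.
by rewrite mulmxnE !pmulrn -!mulrzA mulrC.
Qed.

(** The eigenvector equation is known for some generator v' only. Any other generator is a multiple
    of v', so it has the same eigenvalue. *)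
Lemma eigenmodule_generator (A : 'M[int]_2) (N : nat) (L : {set Zmod2 N})
    (v : Zmod2 N) : free_principal_eigenmodule A L -> L = principal v ->
  exists l : nat, mx_act A v = v *+ l.
Proof.
move=> [v' [L' _ [l eig]]] Lv.
have : v \in L.
  rewrite Lv; apply/imsetP; exists (inZp 1) => //=.
  apply/matrixP => i j; rewrite mulmxnE Zp_mulrn; apply/val_inj => /=.
  by rewrite modnMmr muln1 modn_small.
rewrite L' => /imsetP[k _ ->]; exists l.
by rewrite mx_act_mulrn eig -!mulrnA mulnC.
Qed.

(** Having N elements makes n -> n v injective on Z/NZ, so k v = 0 forces k = 0 there. *)
Lemma principal_order (N : nat) (v : Zmod2 N) (k : nat) : (0 < N)%N ->
  #|principal v| = N ->
  (N %| k * v 0%R 0%R)%N -> (N %| k * v 1%R 0%R)%N -> (N %| k)%N.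
Proof.
case: N v => // n v _ cardv kv0 kv1.
have /imset_injP inj : #|principal v| == #|Zmod n.+1|.
  by rewrite cardv card_ord.
have vk0 : v *+ (inZp k : 'I_n.+1) = v *+ (0%R : 'I_n.+1).
  apply/matrixP => i j; rewrite !mulmxnE mulr0n Zp_mulrn; apply/val_inj => /=.
  rewrite (ord1 j) modnMmr mulnC; apply/eqP.
  case: (unliftP ord0 i) => [i' ->|->]; last exact: kv0.
  by rewrite (ord1 i') (_ : lift ord0 0 = 1)//; exact/val_inj.
by have /(congr1 val)/= /eqP := inj _ _ isT isT vk0.
Qed.

Lemma eigenvector_congr (N : nat) (A : 'M[int]_2) (v : Zmod2 N) (l : nat)
    (i : 'I_2) :
  (0 < N)%N -> mx_act A v = v *+ l ->
  (N %| (A i 0 * (v 0 0 : nat)%:Z + A i 1 * (v 1 0 : nat)%:Z -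
         l%:Z * (v i 0 : nat)%:Z)%R)%Z.
Proof.
case: N v => // n v _ /matrixP/(_ i 0).
rewrite mxE mulmxnE big_ord_recl big_ord1.
rewrite (_ : lift ord0 ord0 = 1); last exact/val_inj.
move=> eig; apply/Zp_intmul_eq0.
rewrite mulrzDr mulrzDr mulrNz ![_ * (nat_of_ord _)%:Z]mulrC !mulrzA.
rewrite -!pmulrn -!Zp_natmulE.
by rewrite eig addrN.
Qed.

(** * Equidistribution for real periodic functions *)

Lemma det_mx22 (R : comRingType) (A : 'M[R]_2) :
  \det A = A 0 0 * A 1 1 - A 0 1 * A 1 0.
Proof.
rewrite (expand_det_row _ 0) !big_ord_recl big_ord0 addr0.
rewrite /cofactor !det_mx11 !mxE /= expr0 mul1r expr1 mulN1r mulrN.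
by congr (A _ _ * A _ _ - A _ _ * A _ _); exact/val_inj.
Qed.

(** The threshold on N is uniform in the generator: it depends only on [S], [g] and [e]. *)
Lemma equidistribution_real (R : realType) (S : 'M[int]_2)
    (g : R * R -> R) (e : R) :
  \det S = 1 -> 2 < \tr S -> continuous g ->
  (forall (x : R * R) (m n : int), g (x.1 + m%:~R, x.2 + n%:~R) = g x) ->
  0 < e -> \forall N \near \oo, forall v : Zmod2 N,
    #|principal v| = N -> (exists l : nat, mx_act S v = v *+ l) ->
    `|N%:R^-1 * \sum_(1 <= n < N.+1)
        g (((v *+ n) 0 0 : nat)%:R / N%:R, ((v *+ n) 1 0 : nat)%:R / N%:R) -
      \int[(@lebesgue_measure R \x @lebesgue_measure R)%E]_(x in unit_square R)
        g x| <= e.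
Proof.
move=> detS trS cg pg e0.
have gunif := periodic_continuous_sup_unif_continuous R g cg pg.
have e20 : 0 < e / 2 by rewrite divr_gt0.
have [d d0 gd] := gunif _ e20.
have detS' : S 0 0 * S 1 1 - S 0 1 * S 1 0 = 1 by rewrite -det_mx22.
have trS' : 2 < S 0 0 + S 1 1.
  move: trS; rewrite /mxtrace big_ord_recl big_ord1.
  by rewrite (_ : lift ord0 ord0 = 1)//; exact/val_inj.
have [C cover] := eigenlattice_covering _ _ _ _ detS' trS'.
(* This makes the rescaled covering radius C / K smaller than [d]. *)
pose K := (Num.truncn (C%:~R / d)).+1.
have KC : C%:~R < K%:R * d by rewrite -ltr_pdivrMr// Num.Theory.truncnS_gt.
near=> N => v cardv [l eig].
have KN : (K * K < N)%N by near: N; exact: nbhs_infty_gt.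
have N0 : (0 < N)%N by exact: leq_ltn_trans KN.
have N0R : 0 < N%:R :> R by rewrite ltr0n.
have Nd : N%:R^-1 <= d.
  rewrite -[d]invrK lef_pV2 ?posrE ?invr_gt0//; near: N; exact: nbhs_infty_ger.
pose G (i j : int) := g (i%:~R / N%:R, j%:~R / N%:R).
have Gper i j m m' : G (i + m * N%:Z) (j + m' * N%:Z) = G i j.
  rewrite /G -[RHS](pg _ m m') /=; congr (g (_, _)).
    by rewrite intrD intrM mulrDl mulfK ?gt_eqF.
  by rewrite intrD intrM mulrDl mulfK ?gt_eqF.
have Gl i j m : G (i + m * N%:Z) j = G i j.
  by rewrite -[RHS](Gper i j m 0) mul0r addr0.
have Gr i j m : G i (j + m * N%:Z) = G i j.
  by rewrite -[RHS](Gper i j 0 m) mul0r addr0.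
have Gv (n : nat) :
    g (((v *+ n) 0 0 : nat)%:R / N%:R, ((v *+ n) 1 0 : nat)%:R / N%:R) =
    G (n%:Z * (v 0 0 : nat)%:Z) (n%:Z * (v 1 0 : nat)%:Z).
  have vn i : n%:Z * (v i 0 : nat)%:Z =
      ((v *+ n) i 0 : nat)%:Z + ((v i 0%R * n) %/ N)%N%:Z * N%:Z.
    rewrite mulmxnE Zmod_mulrnE// -!PoszM -PoszD addnC -divn_eq.
    by rewrite mulnC.
  by rewrite !vn Gper.
(* The average runs over 1, ..., N and the orbit sum over 0, ..., N - 1: a shift by one along a full
   period. *)
have -> : \sum_(1 <= n < N.+1)
    g (((v *+ n) 0 0 : nat)%:R / N%:R, ((v *+ n) 1 0 : nat)%:R / N%:R) =
    \sum_(n < N) G (n%:Z * (v 0 0 : nat)%:Z) (n%:Z * (v 1 0 : nat)%:Z).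
  rewrite big_add1 /= big_mkord.
  rewrite -[RHS](sum_periodic_shift _ N (fun n =>
    G (n * (v 0 0 : nat)%:Z) (n * (v 1 0 : nat)%:Z)) 1).
    by apply: eq_bigr => n _; rewrite Gv -addn1 PoszD.
  move=> n m; rewrite !mulrDl !(mulrAC m N%:Z); exact: Gper.
have near_grid := riemann_sum_near N g d (e / 2) gunif N0 Nd gd.
have near_orbit := orbit_average_near_grid_average R N (v 0 0 : nat)%:Z
  (v 1 0 : nat)%:Z G (e / 2) N0 Gl Gr.
rewrite (splitr e); apply: (le_trans _ (lerD (near_orbit _) near_grid)).
  by rewrite (le_trans _ (ler_normD _ _))// addrA subrK.
move=> i j.
have [k [u [w [iw jw]]]] := cover N K (v 0 0) (v 1 0) l%:Z isT KN
  (fun k => principal_order N v k N0 cardv)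
  (eigenvector_congr N S v l 0 N0 eig) (eigenvector_congr N S v l 1 N0 eig) i j.
exists k, u, w => p q.
have small (z y : int) : `|z| * K%:Z <= C * N%:Z ->
    `|(z + y)%:~R / N%:R - y%:~R / N%:R| <= d :> R.
  rewrite -mulrBl intrD addrK normrM normfV (ger0_norm (ltW N0R)).
  rewrite ler_pdivrMr// -(ler_int R) !intrM intr_norm => zC.
  rewrite -(ler_pM2r (_ : 0 < K%:R))// (le_trans zC)//.
  by rewrite mulrAC ler_pM2r// mulrC ltW.
by apply: gd; exact: small.
Unshelve. all: by end_near. Qed.

(** * Complex functions on the torus *)

Lemma normc_ge_Im (R : rcfType) (z : R[i]) : (`|complex.Im z|%:C)%C <= `|z|.
Proof.
have := normc_ge_Re (z * 'i%C).
rewrite ReiNIm normrN normrM [X in _ * X]normc_def /=.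
by rewrite expr0n expr1n add0r sqrtr1 mulr1.
Qed.

Lemma to_torus_continuous (R : realType) : continuous (@to_torus R).
Proof.
move=> x.
have c1 : (\pi_(circle R)%qT y.1 : circle R) @[y --> x] -->
    (\pi_(circle R)%qT x.1 : circle R).
  apply: (cvg_comp _ _ (@cvg_fst _ _ (nbhs x.1) (nbhs x.2) _)).
  exact: pi_continuous.
have c2 : (\pi_(circle R)%qT y.2 : circle R) @[y --> x] -->
    (\pi_(circle R)%qT x.2 : circle R).
  apply: (cvg_comp _ _ (@cvg_snd _ _ (nbhs x.1) (nbhs x.2) _)).
  exact: pi_continuous.
exact: (cvg_pair c1 c2).
Qed.

Lemma to_torus_periodic (R : realType) (x : R * R) (m n : int) :
  to_torus (x.1 + m%:~R, x.2 + n%:~R) = to_torus x.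
Proof.
have pi_periodic (t : R) (k : int) :
    (\pi_(circle R) (t + k%:~R) = \pi_(circle R) t)%qT.
  have /eqP : (t + k%:~R == t %[mod {ideal_quot (int_subgroup R)}])%qT.
    by rewrite -Quotient.idealrBE addrAC subrr add0r; exact: intr_int.
  exact.
by congr pair; exact: pi_periodic.
Qed.

(** Treats [complex.Re] and [complex.Im] at once. *)
Lemma contraction_comp_torus_continuous (R : realType) (L : R[i] -> R)
    (f : torus R -> R[i]^o) : {morph L : x y / x - y} ->
  (forall z, (`|L z|%:C)%C <= `|z|) -> continuous f ->
  continuous (fun x => L (f (to_torus x))).
Proof.
move=> LB Lle cf x; apply/cvgrPdist_lt => e e0.
have /cvgrPdist_lt /(_ (e%:C)%C) : f (to_torus y) @[y --> x] --> f (to_torus x).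
  by apply: (cvg_comp _ _ (to_torus_continuous R x)); exact: cf.
rewrite ltcR => /(_ e0); apply: filterS => y yx.
by rewrite -LB -ltcR (le_lt_trans (Lle _)).
Qed.

Lemma normc_le_ReIm (R : rcfType) (z : R[i]) :
  `|z| <= (`|complex.Re z| + `|complex.Im z|)%:C%C.
Proof.
rewrite normc_def lecR.
have ab0 := addr_ge0 (normr_ge0 (complex.Re z)) (normr_ge0 (complex.Im z)).
rewrite -(ger0_norm ab0) -(sqrtr_sqr (_ + _)); apply: ler_wsqrtr.
rewrite sqrrD !real_normK ?num_real// lerD2r lerDl.
by rewrite mulrn_wge0// mulr_ge0.
Qed.

Lemma Re_average (R : realType) (N : nat) (f : torus R -> R[i]^o)
    (w : Zmod2 N) :
  complex.Re (average f w) = N%:R^-1 *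
    \sum_(1 <= n < N.+1) complex.Re (f (torsion_point R (w *+ n))).
Proof.
have ReD : {morph (@complex.Re R) : x y / x + y} by move=> [a b] [c d].
rewrite -(big_morph _ ReD (erefl : complex.Re 0 = 0)) /average.
rewrite -(rmorph_nat (real_complex R)) -fmorphV.
by case: (\sum_(_ <= _ < _) _) => a b /=; rewrite mul0r subr0.
Qed.

Lemma Im_average (R : realType) (N : nat) (f : torus R -> R[i]^o)
    (w : Zmod2 N) :
  complex.Im (average f w) = N%:R^-1 *
    \sum_(1 <= n < N.+1) complex.Im (f (torsion_point R (w *+ n))).
Proof.
have ImD : {morph (@complex.Im R) : x y / x + y} by move=> [a b] [c d].
rewrite -(big_morph _ ImD (erefl : complex.Im 0 = 0)) /average.
rewrite -(rmorph_nat (real_complex R)) -fmorphV.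
by case: (\sum_(_ <= _ < _) _) => a b /=; rewrite mul0r addr0.
Qed.

Theorem proposition3 (R : realType) (S : 'M[int]_2)
    (hS : Gamma12 S) (htr : 2 < \tr S)
    (NN : set nat) (hinf : infinite_set NN)
    (hadm : forall N, NN N -> admissible S N)
    (Lambda : forall N, {set Zmod2 N})
    (hLambda : forall N, NN N -> free_principal_eigenmodule S (Lambda N))
    (v : forall N, Zmod2 N)
    (hv : forall N, NN N -> Lambda N = principal (v N))
    (f : torus R -> R[i]^o) (hf : continuous f) :
  average f (v N) @[N --> within NN \oo] --> torus_integral f.
Proof.
have [detS _] := hS.
(* A positive element of [R[i]] has zero imaginary part and positive real part. *)
apply/cvgrPdistC_le => e; rewrite ltcE /= => /andP[/eqP e_im e_re].
have e20 : 0 < complex.Re e / 2 by rewrite divr_gt0.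
have ReB : {morph (@complex.Re R) : x y / x - y} by move=> [a b] [c d].
have ImB : {morph (@complex.Im R) : x y / x - y} by move=> [a b] [c d].
(* The real and the imaginary part each get half of the allowed error. *)
have equi (L : R[i] -> R) (LB : {morph L : x y / x - y})
    (Lle : forall z, (`|L z|%:C)%C <= `|z|) :=
  equidistribution_real R S _ _ detS htr
    (contraction_comp_torus_continuous R L f LB Lle hf)
    (fun x m n => congr1 (L \o f) (to_torus_periodic R x m n)) e20.
have := equi _ ImB (@normc_ge_Im R); have := equi _ ReB (@normc_ge_Re R).
apply: filterS2 => N near_re near_im NNN.
have cardv : #|principal (v N)| = N.
  by have [_ [_ + _]] := hLambda N NNN; rewrite hv.
have eig := eigenmodule_generator _ _ _ _ (hLambda N NNN) (hv N NNN).
rewrite (le_trans (normc_le_ReIm _ _))// lecE /= e_im eqxx /=.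
rewrite (splitr (complex.Re e)).
have := lerD (near_re _ cardv eig) (near_im _ cardv eig).
apply: le_trans; rewrite ReB ImB Re_average Im_average.
exact: lexx.
Qed.
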